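(* Let $\Phi$ be the standard normal CDF and $\eta_0:=2(1-\Phi(\sqrt{2\log 2}))\approx 0.239$. Let $0<\epsilon<0.2$, let $X\in\mathbb{R}^{m\times n}$ have i.i.d. $N(0,1)$ entries with $m\gtrsim\frac{n}{\epsilon^2}$, let $w^*\in\mathbb{R}^n$ be a fixed nonzero vector, and consider observations $y=Xw^*+\zeta+d$ with $\|\zeta\|_0\leq\eta m$, and the $\ell_1$ regression estimator $\widehat{w}\in\operatorname{argmin}_{w\in\mathbb{R}^n}\|y-Xw\|_1$. Then with high probability over $X$: 1. If $\eta>\eta_0+\epsilon$ and $d=0$, there exists a choice of $\zeta$ with $\|\zeta\|_0\leq\eta m$ such that $\ell_1$ regression does not return $w^*$ (i.e. $w^*$ is not a minimizer of $\|y-Xw\|_1$). 2. Even if $\zeta=0$, there exists a choice of $d$ such that $\widehat{w}$ satisfies $\|\widehat{w}-w^*\|_2\gtrsim\frac{\|d\|_1}{m}$.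
   Context: $\|\zeta\|_0$ denotes the number of nonzero entries of $\zeta$. The relations $\gtrsim$ mean inequalities holding up to absolute constant factors. *)

(* Defs.v *)
From HB Require Import structures.
From mathcomp Require Import all_boot all_order all_algebra.
From mathcomp Require Import all_classical all_reals all_analysis.
Set Implicit Arguments. Unset Strict Implicit. Unset Printing Implicit Defensive.
Import Order.TTheory GRing.Theory Num.Theory.
Local Open Scope classical_set_scope.
Local Open Scope ring_scope.

Section defs.
Variable R : realType.

Definition Phi (x : R) : R := fine (normal_prob 0 1 `]-oo, x]).

Definition eta0 : R := 2 * (1 - Phi (Num.sqrt (2 * ln 2))).

Variables m n : nat.

Definition l1norm (v : 'cV[R]_m) : R := \sum_(i < m) `|v i 0|.
Definition l0norm (v : 'cV[R]_m) : nat := #|[set i : 'I_m | v i 0 != 0]|.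
Definition l2norm (v : 'cV[R]_n) : R := Num.sqrt (\sum_(j < n) v j 0 ^+ 2).

Definition l1_argmin (X : 'M[R]_(m, n)) (y : 'cV[R]_m) (w : 'cV[R]_n) : Prop :=
  forall w' : 'cV[R]_n, l1norm (y - X *m w) <= l1norm (y - X *m w').

(* The i.i.d. N(0,1) design: each entry is a real random variable with law
   N(0,1), and the m*n entries are mutually independent (product rule for
   every family of Borel sets; taking some sets = setT gives subfamilies). *)
Definition iid_std_gaussian {dT : measure_display} {T : measurableType dT}
  (P : probability T R) (X : 'I_m -> 'I_n -> T -> R) : Prop :=
  [/\ (forall i j, measurable_fun setT (X i j)),
      (forall i j (B : set R), measurable B ->
          P (X i j @^-1` B) = normal_prob 0 1 B) &
      (forall B : 'I_m -> 'I_n -> set R, (forall i j, measurable (B i j)) ->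
          P [set t | forall i j, B i j (X i j t)] =
          (\prod_(i < m) \prod_(j < n) P (X i j @^-1` B i j))%E)].

Definition design {T : Type} (X : 'I_m -> 'I_n -> T -> R) (t : T) : 'M[R]_(m, n) :=
  \matrix_(i, j) X i j t.

Definition l1_fails (eta : R) (A : 'M[R]_(m, n)) (wstar : 'cV[R]_n) : Prop :=
  exists zeta : 'cV[R]_m,
    (l0norm zeta)%:R <= eta * m%:R /\ ~ l1_argmin A (A *m wstar + zeta) wstar.

Definition l1_dense_error (c : R) (A : 'M[R]_(m, n)) (wstar : 'cV[R]_n) : Prop :=
  exists d : 'cV[R]_m, d != 0 /\
    forall what : 'cV[R]_n, l1_argmin A (A *m wstar + d) what ->
      c * l1norm d / m%:R <= l2norm (what - wstar).

End defs.

(* Main.v *)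
(** Only one column [a] of the design matters for part 1.  Half of the
    mean of [|a_i|] comes from [|a_i| >= tau] with [tau = sqrt (2 ln 2)], an event
    of probability [eta0].  Lowering the threshold slightly below [tau], the
    corruption [zeta_i = a_i] on the entries above the threshold is sparse enough
    and carries more than half of [|a|_1], so moving along that coordinate
    decreases the loss.

    For part 2 take [d = A e_j].  The loss can be made zero, so a minimizer
    [w* + u] satisfies [A u = d]; pairing with [s = sgn d] gives
    [|d|_1 = <A^T s, u> <= |A^T s|_2 |u|_2].  Multiplying the entries of
    another column by the signs [s_i] does not change its law, hence
    [|A^T s|_2^2] is of order [m^2 + n m].  All deviations are controlled by
    second moments. *)

Require Import Defs.
From HB Require Import structures.
From mathcomp Require Import all_boot all_order all_algebra.
From mathcomp Require Import measurable_realfun.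
From mathcomp Require Import all_classical all_reals all_analysis.
From mathcomp Require Import ring lra.
Import Order.TTheory GRing.Theory Num.Theory.
Import numFieldNormedType.Exports.
Set Implicit Arguments.
Unset Strict Implicit.
Unset Printing Implicit Defensive.
Local Open Scope classical_set_scope.
Local Open Scope ring_scope.

(** * Moments and tails of the standard normal law *)

Section normal.
Context {R : realType}.
Local Notation mu := (@lebesgue_measure R).
Local Notation nu := (@normal_prob R 0 1).
Local Open Scope ereal_scope.

(** The normal law is dominated by Lebesgue measure, and its Radon-Nikodym derivative agrees almost
    everywhere with the density because both have the same integral over every measurable set. *)
Lemma ge0_integral_normal_prob (m s : R) (f : R -> \bar R) (E : set R) :
  (forall x, 0 <= f x) -> measurable E -> measurable_fun setT f ->
  \int[normal_prob m s]_(x in E) f x =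
  \int[mu]_(x in E) (f x * (normal_pdf m s x)%:E).
Proof.
move=> f0 mE mf.
have dom := @normal_prob_dominates R m s.
rewrite -(Radon_Nikodym_SigmaFinite.change_of_variables dom)//; last first.
  exact: measurable_funTS.
have mRN : measurable_fun setT
    (Radon_Nikodym_SigmaFinite.f (normal_prob m s) mu).
  exact: measurable_int (Radon_Nikodym_SigmaFinite.f_integrable dom).
have mpdf : measurable_fun setT (fun x => (normal_pdf m s x)%:E : \bar R).
  by apply/measurable_EFinP; exact: measurable_normal_pdf.
apply: ae_eq_integral => //.
- by apply: measurable_funTS; exact: emeasurable_funM.
- by apply: measurable_funTS; exact: emeasurable_funM.
- apply: ae_eqe_mul2l => /=; apply: integral_ae_eq => //=.
  + apply: (integrableS measurableT) => //.
    exact: Radon_Nikodym_SigmaFinite.f_integrable.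
  + exact: measurable_funTS.
  + move=> A AE mA.
    by rewrite -Radon_Nikodym_SigmaFinite.f_integral.
Qed.

Lemma std_normal_pdfE (x : R) :
  normal_pdf 0 1 x = (normal_peak 1 * expR (- (x ^+ 2 / 2)))%R.
Proof.
by rewrite normal_pdfE ?oner_eq0// /normal_fun subr0 expr1n mulNr.
Qed.

(** Lebesgue measure is invariant under reflection and the density is even. *)
Lemma std_normal_prob_oppr (B : set R) : measurable B ->
  nu (-%R @^-1` B) = nu B.
Proof.
move=> mB; rewrite /normal_prob.
transitivity (\int[pushforward mu (-%R : _ -> measurableTypeR R)]_(y in B)
  (normal_pdf 0 1 y)%:E); last first.
  apply: eq_measure_integral => //= A mA AS; exact: lebesgue_measureN.
rewrite ge0_integral_pushforward//=; last 2 first.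
- by apply/measurable_funTS/measurable_EFinP; exact: measurable_normal_pdf.
- by move=> x _; rewrite lee_fin normal_pdf_ge0.
by apply: eq_integral => x _ /=; rewrite !std_normal_pdfE sqrrN.
Qed.

(** Finiteness is enough: the second moment only enters the variance constant [sqr_bound], hence the
    sample size constant. *)
Lemma std_normal_sqr_lty : \int[nu]_x (x ^+ 2)%:E < +oo.
Proof.
rewrite ge0_integral_normal_prob//; last 2 first.
  by move=> x; rewrite lee_fin sqr_ge0.
  by apply/measurable_EFinP; exact: measurable_funX.
pose s : R := Num.sqrt 2.
have s0 : s != 0%R by rewrite gt_eqF// sqrtr_gt0.
pose K : R := (4 * normal_peak 1 / normal_peak s)%R.
(* [y <= exp y] at [y = x^2 / 4] compares with the density of N(0, 2). *)
have bound (x : R) : (x ^+ 2 * normal_pdf 0 1 x <= K * normal_pdf 0 s x)%R.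
  rewrite std_normal_pdfE normal_pdfE// /normal_fun subr0 sqr_sqrtr//.
  have -> : (K * (normal_peak s * expR (- x ^+ 2 / (2 *+ 2))) =
      normal_peak 1 * (4 * expR (- x ^+ 2 / (2 *+ 2))))%R.
    by rewrite /K; field; rewrite gt_eqF// normal_peak_gt0.
  rewrite mulrCA ler_pM2l ?normal_peak_gt0 ?oner_eq0//.
  have -> : (- (x ^+ 2 / 2) = - (x ^+ 2 / 4) + - x ^+ 2 / (2 *+ 2))%R by field.
  rewrite expRD mulrA ler_pM2r ?expR_gt0// expRN.
  rewrite -ler_pdivlMr ?invr_gt0 ?expR_gt0// invrK.
  have := expR_ge1Dx (x ^+ 2 / 4)%R; lra.
apply: (@le_lt_trans _ _ (\int[mu]_x (K%:E * (normal_pdf 0 s x)%:E))).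
  apply: ge0_le_integral => //=.
  - by move=> x _; rewrite -EFinM lee_fin mulr_ge0 ?sqr_ge0 ?normal_pdf_ge0.
  - apply/measurable_EFinP; apply: measurable_funM; first exact: measurable_funX.
    exact: measurable_normal_pdf.
  - apply/measurable_EFinP; apply: measurable_funM => //.
    exact: measurable_normal_pdf.
  - by move=> x _; rewrite -!EFinM lee_fin bound.
rewrite ge0_integralZl//.
- by rewrite integral_normal_pdf mule1 ltry.
- by apply/measurable_EFinP; exact: measurable_normal_pdf.
- by move=> x _; rewrite lee_fin normal_pdf_ge0.
- by rewrite lee_fin !mulr_ge0// ?invr_ge0 ?normal_peak_ge0.
Qed.

(** The density [p] satisfies [p' = - x p], so [- p] is an antiderivative of the integrand and
    vanishes at infinity. *)
Lemma integral_std_normal_tail (t : R) : (0 <= t)%R ->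
  \int[nu]_(x in `[t, +oo[) x%:E =
  (normal_peak 1 * expR (- (t ^+ 2 / 2)))%:E.
Proof.
move=> t0.
pose F (y : R) : R := (- (normal_peak 1 * expR (- (y ^+ 2 / 2))))%R.
pose f (x : R) : R := (x * normal_pdf 0 1 x)%R.
have FD (x : R) : is_derive x 1%R F (f x).
  apply: is_derive_eq.
  by rewrite /f std_normal_pdfE !scaler0 !add0r /GRing.scale/= !mulr1; field.
have cF : continuous F.
  by move=> x; apply: differentiable_continuous; apply/derivable1_diffP; exact: ex_derive.
have cf : continuous f.
  by move=> x; apply: cvgM; [exact: cvg_id|exact: continuous_normal_pdf].
transitivity (\int[mu]_(x in `[t, +oo[) (f x)%:E).
  have mE : measurable (`[t, +oo[ : set R) by exact: measurable_itv.
  transitivity (\int[nu]_(x in `[t, +oo[) (`|x|)%:E).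
    apply: eq_integral => x; rewrite inE/= in_itv/= andbT => tx.
    by rewrite ger0_norm// (le_trans t0).
  rewrite ge0_integral_normal_prob//; last exact/measurable_EFinP.
  apply: eq_integral => x; rewrite inE/= in_itv/= andbT => tx.
  by rewrite -EFinM ger0_norm// (le_trans t0).
rewrite (@ge0_continuous_FTC2y _ f F t 0%R).
- by rewrite sub0e -EFinN /F opprK.
- move=> x tx; rewrite /f mulr_ge0 ?normal_pdf_ge0//; exact: le_trans tx.
- exact: continuous_subspaceT.
- rewrite -oppr0; apply: cvgN; rewrite -(mulr0 (normal_peak 1)).
  apply: cvgM; first exact: cvg_cst.
  apply: (cvg_comp (fun x : R => x ^+ 2 / 2)%R (fun x => expR (- x))%R).
    by apply: gt0_cvgMly; [rewrite invr_gt0|exact: cvgr_expr2].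
  exact: cvgr_expR.
- by move=> x _; exact: ex_derive.
- by apply: cvg_at_right_filter; exact: cF.
- by move=> x _; rewrite derive1E; exact: derive_val.
Qed.

Lemma integral_abs_std_normal : \int[nu]_x (`|x|)%:E = (2 * normal_peak 1)%:E.
Proof.
rewrite ge0_integral_normal_prob//; last exact/measurable_EFinP.
under eq_integral do rewrite -EFinM.
rewrite ge0_symfun_integralT.
- rewrite -set_itvcy EFinM; congr (_ * _).
  transitivity (\int[nu]_(x in `[0%R, +oo[) x%:E); last first.
    by rewrite integral_std_normal_tail// expr0n/= mul0r oppr0 expR0 mulr1.
  transitivity (\int[nu]_(x in `[0%R, +oo[) (`|x|)%:E); last first.
    apply: eq_integral => x; rewrite inE/= in_itv/= andbT => x0.
    by rewrite ger0_norm.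
  by rewrite ge0_integral_normal_prob//; exact/measurable_EFinP.
- by move=> x; rewrite mulr_ge0// normal_pdf_ge0.
- move=> x; apply: cvgM; first exact: norm_continuous.
  by apply: continuous_normal_pdf; rewrite oner_eq0.
- by move=> x /=; rewrite normrN !std_normal_pdfE sqrrN.
Qed.

Lemma ge0_integral_std_normal_oppr (f : R -> \bar R) (B : set R) :
  measurable B -> measurable_fun setT f -> (forall x, 0 <= f x) ->
  \int[nu]_(x in -%R @^-1` B) f (- x)%R = \int[nu]_(x in B) f x.
Proof.
move=> mB mf f0.
transitivity (\int[pushforward nu (-%R : R -> measurableTypeR R)]_(y in B) f y).
  rewrite ge0_integral_pushforward//; exact: measurable_funTS.
by apply: eq_measure_integral => A mA _; exact: std_normal_prob_oppr.
Qed.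

(** By symmetry the integral equals its opposite; integrability makes it finite, so it is zero. *)
Lemma integral_std_normal_id : \int[nu]_x x%:E = 0.
Proof.
have intid : nu.-integrable setT (EFin : R -> \bar R).
  apply/integrableP; split; first exact/measurable_EFinP.
  by rewrite integral_abs_std_normal ltry.
have intN : nu.-integrable setT (EFin \o (-%R : R -> R)).
  by have := integrableN intid; apply: eq_integrable.
have : \int[nu]_x x%:E = \int[nu]_x (- x)%:E.
  transitivity (\int[pushforward nu (-%R : R -> measurableTypeR R)]_y y%:E).
    by apply: eq_measure_integral => A mA _; exact/esym/std_normal_prob_oppr.
  by rewrite integral_pushforward//; exact/measurable_EFinP.
under [RHS]eq_integral do rewrite EFinN.
rewrite integralN; last exact: integrable_add_def.
have /fineK <- := integrable_fin_num measurableT intid.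
by rewrite -EFinN => -[] /eqP; rewrite -addr_eq0 -mulr2n mulrn_eq0/= => /eqP ->.
Qed.

Definition abs_ge (t : R) : set R := [set x | (t <= `|x|)%R].

Lemma abs_geE (t : R) : abs_ge t = `[t, +oo[ `|` -%R @^-1` `[t, +oo[.
Proof.
apply/seteqP; split => x /=; rewrite !in_itv/= !andbT /abs_ge/= ler_normr.
  by move=> /orP.
by move=> ?; apply/orP.
Qed.

Lemma abs_ge_disjoint (t : R) : (0 < t)%R ->
  [disjoint `[t, +oo[ & -%R @^-1` `[t, +oo[].
Proof.
move=> t0; apply/disj_setPS => x [] /=; rewrite !in_itv/= !andbT.
by move=> tx tNx; lra.
Qed.

Lemma measurable_abs_ge (t : R) : measurable (abs_ge t).
Proof.
rewrite abs_geE opp_preimage_itvbndy.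
by apply: measurableU; exact: measurable_itv.
Qed.

(** The two tails contribute equally. At [t = sqrt (2 ln 2)] the exponential is [1/2], so exactly
    half of the mean of [|x|] lies in the tails. *)
Lemma integral_abs_std_normal_tail (t : R) : (0 < t)%R ->
  \int[nu]_(x in abs_ge t) (`|x|)%:E =
  (2 * normal_peak 1 * expR (- (t ^+ 2 / 2)))%:E.
Proof.
move=> t0.
have mN : measurable (-%R @^-1` `[t, +oo[ : set R).
  by rewrite opp_preimage_itvbndy; exact: measurable_itv.
have half : \int[nu]_(x in `[t, +oo[) (`|x|)%:E =
    (normal_peak 1 * expR (- (t ^+ 2 / 2)))%:E.
  rewrite -integral_std_normal_tail ?ltW//.
  apply: eq_integral => x; rewrite inE/= in_itv/= andbT => tx.
  by rewrite ger0_norm// ltW// (lt_le_trans t0).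
rewrite abs_geE ge0_integral_setU//=.
- have {2}-> : (fun x : R => (`|x|)%:E) = (fun x : R => (`|- x|)%:E).
    by apply/funext => x; rewrite normrN.
  rewrite (@ge0_integral_std_normal_oppr (fun x => (`|x|)%:E))//.
  + by rewrite half -EFinD; congr EFin; ring.
  + exact/measurable_EFinP.
- by apply/measurable_EFinP; exact: measurable_funTS.
- exact: abs_ge_disjoint.
Qed.

Lemma normal_peak1_le : (normal_peak 1 <= 2^-1 :> R)%R.
Proof.
rewrite /normal_peak expr1n mul1r lef_pV2 ?posrE// ?sqrtr_gt0; last first.
  by rewrite mulrn_wgt0// pi_gt0.
have -> : (2 = Num.sqrt (2 ^+ 2) :> R)%R by rewrite sqrtr_sqr ger0_norm.
have := pi_ge2 R; rewrite -[(pi *+ 2)%R]mulr_natr => pi2.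
by rewrite ler_sqrt; lra.
Qed.

(** This is the price of lowering the threshold from [u] to [t]: the density is at most [1/2], so
    each side gains at most [(u - t) / 2]. *)
Lemma std_normal_abs_ge_le (t u : R) : (0 < t)%R -> (t <= u)%R ->
  nu (abs_ge t) <= (2 * (1 - Phi u) + (u - t))%:E.
Proof.
move=> t0 tu.
have mN : measurable (-%R @^-1` `[t, +oo[ : set R).
  by rewrite opp_preimage_itvbndy; exact: measurable_itv.
rewrite abs_geE measureU//=; last first.
  exact/disj_set2P/abs_ge_disjoint.
rewrite std_normal_prob_oppr//.
have -> : `[t, +oo[%classic = `[t, u] `|` `]u, +oo[ :> set R.
  by rewrite -itv_bndbnd_setU// bnd_simp.
have mid : nu `[t, u] <= (2^-1 * (u - t))%:E.
  rewrite /normal_prob.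
  apply: (@le_trans _ _ (\int[mu]_(x in `[t, u]) (2^-1)%:E)).
    apply: ge0_le_integral => //=.
    - by move=> x _; rewrite lee_fin normal_pdf_ge0.
    - apply/measurable_funTS/measurable_EFinP; exact: measurable_normal_pdf.
    - move=> x _; rewrite lee_fin; apply: le_trans normal_peak1_le.
      by apply: normal_pdf_ub; rewrite oner_eq0.
  rewrite integral_cst//= lebesgue_measure_itv/= lte_fin.
  case: ifPn => [_|]; first by rewrite -EFinD -EFinM.
  by rewrite mule0 lee_fin -leNgt => ut; rewrite mulr_ge0 ?invr_ge0// subr_ge0.
have tail : nu `]u, +oo[ = (1 - Phi u)%:E.
  rewrite -setCitvl probability_setC// /Phi EFinB fineK//.
  exact: fin_num_measure.
rewrite measureU//=; last by rewrite -subset0 => x [] /=; rewrite !in_itv/=; lra.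
rewrite tail; apply: (@le_trans _ _ ((2^-1 * (u - t) + (1 - Phi u)) +
  (2^-1 * (u - t) + (1 - Phi u)))%:E); last by rewrite lee_fin; lra.
by rewrite [leRHS]EFinD; apply: leeD; rewrite [leRHS]EFinD leeD2r.
Qed.

(** It comes from [(|x| + B)^2 <= 2 x^2 + 2 B^2], and so bounds the second moment of every [f] with
    [|f x| <= |x| + B] at once. *)
Definition sqr_bound (B : R) : R :=
  (2 * fine (\int[nu]_x (x ^+ 2)%:E) + 2 * B ^+ 2)%R.

Lemma integrable_std_normal (f : R -> R) (B : R) : measurable_fun setT f ->
  (0 <= B)%R -> (forall x, `|f x| <= `|x| + B)%R ->
  nu.-integrable setT (EFin \o f).
Proof.
move=> mf B0 fB.
have intabs : nu.-integrable setT (fun x : R => (`|x|)%:E).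
  apply/integrableP; split; first exact/measurable_EFinP.
  under eq_integral do rewrite gee0_abs//.
  by rewrite integral_abs_std_normal ltry.
have intB : nu.-integrable setT (EFin \o cst B).
  exact: finite_measure_integrable_cst.
apply: (le_integrable _ _ _ (integrableD measurableT intabs intB)) => //=.
  exact/measurable_EFinP.
by move=> x _; rewrite lee_fin (le_trans (fB x))// ler_norm.
Qed.

Lemma integral_sqr_std_normal_le (f : R -> R) (B : R) : measurable_fun setT f ->
  (0 <= B)%R -> (forall x, `|f x| <= `|x| + B)%R ->
  \int[nu]_x (f x ^+ 2)%:E <= (sqr_bound B)%:E.
Proof.
move=> mf B0 fB.
have sqr_ge0E (x : R) : 0 <= (x ^+ 2)%:E by rewrite lee_fin sqr_ge0.
have m2 : measurable_fun setT (fun x : R => (x ^+ 2)%:E).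
  by apply/measurable_EFinP; exact: measurable_funX.
apply: (@le_trans _ _ (\int[nu]_x (2%:E * (x ^+ 2)%:E + (2 * B ^+ 2)%:E))).
  apply: ge0_le_integral => //=.
  - by apply/measurable_EFinP; exact: measurable_funX.
  - by apply: emeasurable_funD => //; apply: emeasurable_funM.
  - move=> x _; rewrite -EFinM -EFinD lee_fin.
    apply: (@le_trans _ _ ((`|x| + B) ^+ 2)%R).
      by rewrite -[leLHS]real_normK ?num_real// ler_sqr ?nnegrE ?addr_ge0.
    rewrite -[in leRHS](real_normK (num_real x)).
    by have := sqr_ge0 (`|x| - B)%R; rewrite !expr2; nra.
rewrite ge0_integralD//; last 3 first.
  by move=> x _; rewrite mule_ge0.
  by apply: emeasurable_funM.
  by move=> x _; rewrite lee_fin mulr_ge0// sqr_ge0.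
rewrite ge0_integralZl// integral_cst//= probability_setT mule1.
rewrite -[X in 2%:E * X]fineK; first by rewrite -EFinM -EFinD.
by rewrite ge0_fin_numE ?std_normal_sqr_lty// integral_ge0.
Qed.

Lemma sqr_bound_ge1 (B : R) : (1 <= B)%R -> (1 <= sqr_bound B)%R.
Proof.
move=> B1; rewrite /sqr_bound.
have : (0 <= fine (\int[nu]_x (x ^+ 2)%:E))%R.
  by rewrite fine_ge0// integral_ge0// => x _; rewrite lee_fin sqr_ge0.
rewrite expr2; nra.
Qed.

End normal.

(** * Second moments of sums of pairwise independent normal variables *)

Section independence.
Context {R : realType} {d : measure_display} {T : measurableType d}.
Variable P : probability T R.
Local Open Scope ereal_scope.

(** The product rule on rectangles identifies the joint law of [(U, V)] with the product measure;
    Fubini then factors the integral. *)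
Lemma integral_indepM (mu1 mu2 : probability (measurableTypeR R) R)
    (U V : T -> R) (f g : R -> R) :
  measurable_fun setT U -> measurable_fun setT V ->
  (forall A B, measurable A -> measurable B ->
    P (U @^-1` A `&` V @^-1` B) = mu1 A * mu2 B) ->
  mu1.-integrable setT (EFin \o f) -> mu2.-integrable setT (EFin \o g) ->
  P.-integrable setT (fun t => (f (U t) * g (V t))%:E) /\
  \int[P]_t (f (U t) * g (V t))%:E =
  (\int[mu1]_x (f x)%:E) * (\int[mu2]_x (g x)%:E).
Proof.
move=> mU mV UV intf intg.
have mf : measurable_fun setT f by apply/measurable_EFinP; exact: measurable_int intf.
have mg : measurable_fun setT g by apply/measurable_EFinP; exact: measurable_int intg.
pose phi t : measurableTypeR R * measurableTypeR R := (U t, V t).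
have mphi : measurable_fun setT phi by exact: measurable_fun_pair.
pose F (z : measurableTypeR R * measurableTypeR R) : \bar R := (f z.1 * g z.2)%:E.
have mF : measurable_fun setT F.
  by apply/measurable_EFinP; apply: measurable_funM; exact: measurableT_comp.
have pushE X : measurable X -> (mu1 \x mu2) X = pushforward P phi X.
  by move=> mX; apply: product_measure_unique.
have intF : (mu1 \x mu2).-integrable setT F.
  apply/integrable12ltyP => //=.
  under eq_integral => x _.
    under eq_integral do rewrite normrM EFinM.
    rewrite ge0_integralZl//; last first.
      by apply/measurable_EFinP; exact: measurableT_comp.
    over.
  rewrite ge0_integralZr//=; last 2 first.
    by apply/measurable_EFinP; exact: measurableT_comp.
    exact: integral_ge0.
  apply: lte_mul_pinfty; first exact: integral_ge0.
    rewrite ge0_fin_numE; last exact: integral_ge0.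
    by case/integrableP : intf.
  by case/integrableP : intg.
have intFphi : P.-integrable setT (F \o phi).
  apply/integrableP; split; first exact: measurableT_comp.
  case/integrableP : intF => _; apply: le_lt_trans.
  rewrite (eq_measure_integral (pushforward P phi)) => [|X mX _]; last exact: pushE.
  rewrite ge0_integral_pushforward//; exact: measurableT_comp.
split => //.
transitivity (\int[mu1 \x mu2]_z F z).
  rewrite (eq_measure_integral (pushforward P phi)) => [|X mX _]; last exact: pushE.
  by rewrite integral_pushforward.
rewrite -integral12_prod_meas1//= /fubini_F/F/=.
under eq_integral => x _.
  under eq_integral do rewrite EFinM.
  rewrite integralZl//.
  over.
have /fineK <- := integrable_fin_num measurableT intg.
by rewrite integralZr.
Qed.

(** Expanding the square leaves only the [m] diagonal terms, since the cross terms integrate to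
    zero. *)
Lemma integral_sqr_sum_le (m : nat) (Y : 'I_m -> T -> R) (v : R) :
  (forall i, measurable_fun setT (Y i)) ->
  (forall i, \int[P]_t (Y i t ^+ 2)%:E <= v%:E) ->
  (forall i k, i != k -> P.-integrable setT (fun t => (Y i t * Y k t)%:E) /\
     \int[P]_t (Y i t * Y k t)%:E = 0) ->
  \int[P]_t ((\sum_(i < m) Y i t) ^+ 2)%:E <= (m%:R * v)%:E.
Proof.
move=> mY Yv Yik.
have int2 i k : P.-integrable setT (fun t => (Y i t * Y k t)%:E).
  have [<-|/Yik[]//] := eqVneq i k.
  apply/integrableP; split.
    by apply/measurable_EFinP; exact: measurable_funM.
  apply: (le_lt_trans _ (ltry v)); apply: le_trans (Yv i).
  rewrite le_eqVlt; apply/orP; left; apply/eqP; apply: eq_integral => t _ /=.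
  by rewrite -expr2 ger0_norm ?sqr_ge0.
under eq_integral => t _.
  rewrite expr2 mulr_suml -sumEFin.
  under eq_bigr do rewrite mulr_sumr -sumEFin.
  over.
rewrite integral_sum//=; last by move=> i; exact: integrable_sum.
apply: (@le_trans _ _ (\sum_(i < m) v%:E)); last first.
  by rewrite sumEFin sumr_const card_ord mulr_natl.
apply: lee_sum => i _; rewrite integral_sum//=.
rewrite (bigD1 i)//= [X in _ + X]big1 => [|k ki].
  by rewrite adde0; apply: le_trans (Yv i); under eq_integral do rewrite -expr2.
by case: (Yik i k) => //; rewrite eq_sym.
Qed.

Lemma markov_le (g : T -> R) (v a : R) : measurable_fun setT g ->
  (forall t, 0 <= g t)%R -> (0 < a)%R -> \int[P]_t (g t)%:E <= v%:E ->
  P [set t | (a <= g t)%R] <= (v / a)%:E.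
Proof.
move=> mg g0 a0 gv.
have := @le_integral_comp_abse _ _ _ P _ measurableT (EFin \o g) a id.
rewrite setTI /= => H.
rewrite EFinM muleC -lee_pdivrMl ?invr_gt0// invrK.
have -> : [set t | (a <= g t)%R] = [set t | a%:E <= (`|g t|)%:E].
  by apply/seteqP; split => t /=; rewrite lee_fin ger0_norm.
apply: (le_trans (H _ _ _ _ _)) => //; first exact/measurable_EFinP.
by apply: le_trans gv; under eq_integral do rewrite ger0_norm//.
Qed.

Local Notation nu := (@normal_prob R 0 1).

(** Second moments of sums only see pairs of indices. Asking for pairwise independence keeps the
    verification for sign-flipped columns down to two rows at a time. *)
Definition pairwise_std_normal (m : nat) (W : 'I_m -> T -> R) :=
  [/\ forall i, measurable_fun setT (W i),
      forall i B, measurable B -> P (W i @^-1` B) = nu B &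
      forall i k A B, i != k -> measurable A -> measurable B ->
        P (W i @^-1` A `&` W k @^-1` B) = nu A * nu B].

Lemma integral_sqr_sum_std_normal_le (m : nat) (W : 'I_m -> T -> R)
    (f : R -> R) (B : R) :
  pairwise_std_normal W -> measurable_fun setT f -> (0 <= B)%R ->
  (forall x, `|f x| <= `|x| + B)%R -> \int[nu]_x (f x)%:E = 0 ->
  \int[P]_t ((\sum_(i < m) f (W i t)) ^+ 2)%:E <= (m%:R * sqr_bound B)%:E.
Proof.
move=> [mW lW pW] mf B0 fB f0.
have intf := integrable_std_normal mf B0 fB.
apply: (@integral_sqr_sum_le m (fun i t => f (W i t))) => [i|i|i k ik].
- exact: measurableT_comp.
- apply: le_trans (integral_sqr_std_normal_le mf B0 fB).
  have m2 : measurable_fun setT (fun x : measurableTypeR R => (f x ^+ 2)%:E).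
    by apply/measurable_EFinP; exact: measurable_funX.
  rewrite le_eqVlt; apply/orP; left; apply/eqP.
  transitivity (\int[pushforward P (W i : T -> measurableTypeR R)]_x (f x ^+ 2)%:E).
    rewrite ge0_integral_pushforward//=; first exact: mW.
    by move=> x _; rewrite lee_fin sqr_ge0.
  by apply: eq_measure_integral => [|mWi A mA _]; [exact: mW|exact: lW].
- have [intP intE] := integral_indepM (mu1 := nu) (mu2 := nu) (mW i) (mW k)
    (fun A B mA mB => pW i k A B ik mA mB) intf intf.
  by split => //; rewrite intE f0 mul0e.
Qed.

Lemma std_normal_chebyshev (m : nat) (W : 'I_m -> T -> R)
    (f : R -> R) (B a : R) :
  pairwise_std_normal W -> measurable_fun setT f -> (0 <= B)%R ->
  (forall x, `|f x| <= `|x| + B)%R -> \int[nu]_x (f x)%:E = 0 -> (0 < a)%R ->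
  P [set t | (a <= `|\sum_(i < m) f (W i t)|)%R] <=
  (m%:R * sqr_bound B / a ^+ 2)%:E.
Proof.
move=> hW mf B0 fB f0 a0.
have -> : [set t | (a <= `|\sum_(i < m) f (W i t)|)%R] =
    [set t | (a ^+ 2 <= (\sum_(i < m) f (W i t)) ^+ 2)%R].
  apply/funext => t /=.
  by rewrite -(real_normK (num_real (\sum_(i < m) _))) ler_sqr ?nnegrE// ltW.
apply: markov_le.
- by case: hW => mW _ _; apply: measurable_funX; apply: measurable_sum => i;
    exact: measurableT_comp.
- by move=> t; exact: sqr_ge0.
- by rewrite exprn_gt0.
- exact: integral_sqr_sum_std_normal_le.
Qed.

End independence.

(** The value at [0] is [1], so the sign is never zero and multiplying by it either keeps or
    reflects a number. *)
Definition signr {R : realType} (x : R) : R := if 0 <= x then 1 else -1.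

(** * Laws of rows, columns and sign-flipped columns of the design *)

Section design.
Context {R : realType} {d : measure_display} {T : measurableType d}.
Variables (P : probability T R) (m n : nat) (X : 'I_m -> 'I_n -> T -> R).
Hypothesis iidX : iid_std_gaussian P X.
Local Open Scope ereal_scope.
Local Notation nu := (@normal_prob R 0 1).

(** The product rule for the whole matrix is applied with [setT] in every other row, where the
    factors are [1]. *)
Lemma design_row_prob (i : 'I_m) (F : 'I_n -> set R) :
  (forall q, measurable (F q)) ->
  P [set t | forall q, F q (X i q t)] = \prod_(q < n) nu (F q).
Proof.
case: iidX => mX lX pX mF.
pose B p q : set R := if p == i then F q else setT.
have mB p q : measurable (B p q) by rewrite /B; case: ifP.
have -> : [set t | forall q, F q (X i q t)] =
    [set t | forall p q, B p q (X p q t)].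
  apply/seteqP; split => t /= h => [p q|q].
    by rewrite /B; case: eqP => // ->.
  by have := h i q; rewrite /B eqxx.
rewrite pX// (bigD1 i)//= [X in _ * X]big1 => [|p /negPf pi].
  by rewrite mule1; apply: eq_bigr => q _; rewrite lX// /B eqxx.
by apply: big1 => q _; rewrite /B pi preimage_setT probability_setT.
Qed.

Lemma design_rows_prob (i k : 'I_m) (F G : 'I_n -> set R) : i != k ->
  (forall q, measurable (F q)) -> (forall q, measurable (G q)) ->
  P [set t | forall q, F q (X i q t) /\ G q (X k q t)] =
  \prod_(q < n) nu (F q) * \prod_(q < n) nu (G q).
Proof.
case: iidX => mX lX pX ik mF mG.
pose B p q : set R := if p == i then F q else if p == k then G q else setT.
have mB p q : measurable (B p q) by rewrite /B; do 2 case: ifP => // _.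
have ki : (k == i) = false by rewrite eq_sym (negPf ik).
have -> : [set t | forall q, F q (X i q t) /\ G q (X k q t)] =
    [set t | forall p q, B p q (X p q t)].
  apply/seteqP; split => t /= h => [p q|q].
    by have [? ?] := h q; rewrite /B; case: eqP => [->//|_]; case: eqP => // ->.
  by have := h i q; have := h k q; rewrite /B !eqxx ki.
rewrite pX// (bigD1 i)//= (bigD1 k) ?ki//= [X in _ * (_ * X)]big1.
  by rewrite mule1; congr (_ * _); apply: eq_bigr => q _; rewrite lX// /B eqxx ?ki.
move=> p /andP[/negPf pi /negPf pk].
by apply: big1 => q _; rewrite /B pi pk preimage_setT probability_setT.
Qed.

Lemma pairwise_std_normal_col (j : 'I_n) :
  pairwise_std_normal P (fun i => X i j).
Proof.
have := iidX; case=> mX lX _; split => [i|i B mB|i k A B ik mA mB].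
- exact: mX.
- exact: lX.
pose F (C : set R) q : set R := if q == j then C else setT.
have mF C q : measurable C -> measurable (F C q) by rewrite /F; case: ifP.
have prodF C : measurable C -> \prod_(q < n) nu (F C q) = nu C.
  move=> mC; rewrite (bigD1 j)//= big1 => [|q /negPf qj].
    by rewrite mule1 /F eqxx.
  by rewrite /F qj probability_setT.
rewrite -(prodF _ mA) -(prodF _ mB) -(design_rows_prob ik) => [|q|q]; [|exact: mF..].
congr (P _); apply/seteqP; split => t /=.
  by move=> [Ai Bk] q; rewrite /F; case: eqP => // ->.
by move=> /(_ j); rewrite /F eqxx.
Qed.

Lemma measurable_signr : measurable_fun setT (@signr R).
Proof.
apply: measurable_fun_ifT => //; exact: measurable_fun_ler.
Qed.

Section signed.
Variables (j0 j : 'I_n).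
Hypothesis jj0 : j != j0.

Let sgnset (b : bool) : set R :=
  if b then [set x | (0 <= x)%R] else ~` [set x | (0 <= x)%R].
Let flip (b : bool) (A : set R) : set R := if b then A else -%R @^-1` A.
(** When [X i j0] has sign [b], the condition that the signed entry [W i] lies in [A] is a box
    condition on row [i]: the sign at [j0], and [A] or its reflection at [j]. The product rule for
    boxes then applies inside each sign cell. *)
Let cells b A q : set R :=
  if q == j0 then sgnset b else if q == j then flip b A else setT.

Let msgn b : measurable (sgnset b).
Proof.
have mpos : measurable [set x : R | (0 <= x)%R].
  by rewrite -set_itvcy; exact: measurable_itv.
by case: b => //=; exact: measurableC.
Qed.

Let mflip b A : measurable A -> measurable (flip b A).
Proof.
move=> mA; case: b => //=; rewrite -[X in measurable X]setTI.
have mN : measurable_fun setT (-%R : R -> R) by [].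
exact: mN.
Qed.

Let mcells b A q : measurable A -> measurable (cells b A q).
Proof. by move=> mA; rewrite /cells; do 2 case: ifP => // _; exact: mflip. Qed.

Let prod_cells b A : measurable A ->
  \prod_(q < n) nu (cells b A q) = nu (sgnset b) * nu A.
Proof.
move=> mA; rewrite (bigD1 j0)//= (bigD1 j)//= big1 => [|q /andP[/negPf q0 /negPf qj]].
  rewrite mule1 /cells eqxx (negPf jj0) eqxx; congr (_ * _).
  by case: b => //=; exact: std_normal_prob_oppr.
by rewrite /cells q0 qj probability_setT.
Qed.

Let sgn_sum : nu (sgnset true) + nu (sgnset false) = 1.
Proof.
have mS := msgn true.
by rewrite /= probability_setC//= addeC subeK// fin_num_measure.
Qed.

Let W (i : 'I_m) t : R := (signr (X i j0 t) * X i j t)%R.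

Let WE b i A t : sgnset b (X i j0 t) -> A (W i t) = flip b A (X i j t).
Proof.
rewrite /W /signr; case: b => /= [->|/negP/negPf ->]; first by rewrite mul1r.
by rewrite mulN1r.
Qed.

Let mW i : measurable_fun setT (W i).
Proof.
case: iidX => mX _ _; apply: measurable_funM; last exact: mX.
by apply: measurableT_comp; [exact: measurable_signr|exact: mX].
Qed.

Let split_sgn i (D : set T) : measurable D ->
  P D = P (D `&` X i j0 @^-1` sgnset true) + P (D `&` X i j0 @^-1` sgnset false).
Proof.
case: iidX => mX _ _ mD.
have mS : measurable (X i j0 @^-1` sgnset true).
  by rewrite -[X in measurable X]setTI; exact: mX.
by rewrite (measureDI P mD mS) addeC.
Qed.

Let mpre i A : measurable A -> measurable (W i @^-1` A).
Proof. by move=> mA; rewrite -[X in measurable X]setTI; exact: mW. Qed.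

Let mpre0 i b : measurable (X i j0 @^-1` sgnset b).
Proof.
by case: iidX => mX _ _; rewrite -[X in measurable X]setTI; exact: mX.
Qed.

Let cellsE b i A t : (forall q, cells b A q (X i q t)) <->
  W i t \in A /\ sgnset b (X i j0 t).
Proof.
split=> [h|[AW sX] q].
  have sX : sgnset b (X i j0 t) by have := h j0; rewrite /cells eqxx.
  split => //; rewrite inE (WE _ sX).
  by have := h j; rewrite /cells (negPf jj0) eqxx.
rewrite /cells; case: eqP => [->//|_]; case: eqP => // ->.
by rewrite -(WE _ sX) -inE.
Qed.

Let one b i A : measurable A ->
  P (W i @^-1` A `&` X i j0 @^-1` sgnset b) = nu (sgnset b) * nu A.
Proof.
move=> mA; rewrite -prod_cells// -(design_row_prob i) => [|q]; last exact: mcells.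
congr (P _); apply/seteqP; split => t /=.
  by move=> [AW sX]; apply/cellsE; rewrite inE.
by move=> /cellsE[/[!inE]].
Qed.

Let two b c i k A B : i != k -> measurable A -> measurable B ->
  P (W i @^-1` A `&` W k @^-1` B `&` X i j0 @^-1` sgnset b `&`
     X k j0 @^-1` sgnset c) =
  (nu (sgnset b) * nu A) * (nu (sgnset c) * nu B).
Proof.
move=> ik mA mB; rewrite -!prod_cells// -(design_rows_prob ik); last 2 first.
- by move=> q; exact: mcells.
- by move=> q; exact: mcells.
congr (P _); apply/seteqP; split => t /=.
  move=> [[[AW BW] sX] sX'] q; split.
    by move: q; apply/cellsE; rewrite inE.
  by move: q; apply/cellsE; rewrite inE.
move=> h.
have /cellsE[/[!inE] ? ?] : forall q, cells b A q (X i q t) by move=> q; case: (h q).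
have /cellsE[/[!inE] ? ?] : forall q, cells c B q (X k q t) by move=> q; case: (h q).
by [].
Qed.

(** Inside a sign cell the entry is kept or reflected, and reflection preserves the normal law.
    Summing over the two cells for one row, or the four cells for two rows, removes the signs
    because their probabilities add up to one. *)
Lemma pairwise_std_normal_signr_col :
  pairwise_std_normal P (fun i t => signr (X i j0 t) * X i j t)%R.
Proof.
split => [i|i A mA|i k A B ik mA mB]; first exact: mW.
  by rewrite (split_sgn i (mpre i mA)) !one// -ge0_muleDl// sgn_sum mul1e.
have finE C : measurable C -> nu C = (fine (nu C))%:E.
  by move=> mC; rewrite fineK// fin_num_measure.
have mD : measurable (W i @^-1` A `&` W k @^-1` B).
  by apply: measurableI; exact: mpre.
rewrite (split_sgn i mD) !(split_sgn k (measurableI _ _ mD _))// !two//.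
(* All measures are finite, so the sum over the four cells becomes the real identity
   [(p + q)^2 * a * b = a * b] with [p + q = 1]. *)
move: sgn_sum; rewrite (finE _ (msgn true)) (finE _ (msgn false)).
rewrite (finE _ mA) (finE _ mB) -!EFinM -!EFinD => -[].
move: (fine _) (fine _) (fine (nu A)) (fine (nu B)) => p q a b pq.
by congr EFin; have -> : p = (1 - q)%R; [lra|ring].
Qed.

End signed.
End design.

(** * Deterministic criteria for the two failure modes *)

(** This is the drop of the loss in one row, with design entry [x], when the weight moves one unit
    along that coordinate: from [|x|] to [0] if the row is corrupted by [x], from [0] to [|x|]
    otherwise. *)
Definition abs_step {R : realType} (t x : R) : R :=
  if t <= `|x| then `|x| else - `|x|.

Definition abs_ge_ind {R : realType} (t x : R) : R := if t <= `|x| then 1 else 0.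

Section deterministic.
Context {R : realType} {m n : nat}.
Implicit Types (A : 'M[R]_(m, n)) (w u : 'cV[R]_n) (j : 'I_n).

(** The corruption copies column [j] on its entries of absolute value at least [t]. The competitor
    [w + e_j] then beats [w] by exactly the sum of the [abs_step] terms. *)
Lemma l1_fails_threshold A j (t eta : R) w :
  \sum_(i < m) abs_ge_ind t (A i j) <= eta * m%:R ->
  0 < \sum_(i < m) abs_step t (A i j) -> l1_fails eta A w.
Proof.
move=> card_le sum_gt0.
exists (\col_i if t <= `|A i j| then A i j else 0); split.
  apply: le_trans card_le; rewrite /l0norm -sum1_card natr_sum big_mkcond/=.
  apply: ler_sum => i _; rewrite /abs_ge_ind.
  case: ifPn => [|_]; last by case: ifP.
  by rewrite unfold_in => /asboolP/=; rewrite mxE; case: ifP; rewrite ?eqxx.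
move=> /(_ (w + delta_mx j 0)); apply/negP; rewrite -ltNge.
rewrite mulmxDr -colE; set z := \col_i _.
have -> : A *m w + z - A *m w = z by rewrite addrC addKr.
have -> : A *m w + z - (A *m w + col j A) = z - col j A.
  by rewrite opprD addrA [A *m w + z]addrC addrK.
rewrite /l1norm -subr_gt0 -sumrB; congr (0 < _): sum_gt0.
apply: eq_bigr => i _; rewrite !mxE /abs_step.
by case: ifP => _; [rewrite subrr normr0 subr0|rewrite sub0r normrN normr0 sub0r].
Qed.

Lemma l1norm_eq0 (v : 'cV[R]_m) : l1norm v <= 0 -> v = 0.
Proof.
move=> v0; apply/matrixP => i k; rewrite (ord1 k) mxE; apply/eqP.
rewrite -normr_le0 (le_trans _ v0)// /l1norm (bigD1 i)//= lerDl.
exact: sumr_ge0.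
Qed.

Lemma cauchy_schwarz_l2norm (b : 'I_n -> R) u (K : R) : 0 < K ->
  \sum_(q < n) b q ^+ 2 <= K ^+ 2 ->
  \sum_(q < n) b q * u q 0 <= K * l2norm u.
Proof.
move=> K0 bK; set N := l2norm u.
have N2 : \sum_(q < n) u q 0 ^+ 2 = N ^+ 2.
  by rewrite sqr_sqrtr// sumr_ge0// => q _; exact: sqr_ge0.
have [N0|N0] := eqVneq N 0.
  have u0 q : u q 0 = 0.
    apply/eqP; rewrite -sqrf_eq0; apply/eqP.
    move: N2; rewrite N0 expr0n/= => /psumr_eq0P; apply => // k _.
    exact: sqr_ge0.
  by rewrite N0 mulr0 big1// => q _; rewrite u0 mulr0.
have Np : 0 < N by rewrite lt_neqAle eq_sym N0 sqrtr_ge0.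
(* After scaling by [2 K N], each term is bounded through [(N b_q - K u_q)^2 >= 0]. *)
rewrite -(ler_pM2l (mulr_gt0 (ltr0n _ 2) (mulr_gt0 K0 Np))).
apply: (@le_trans _ _ (\sum_(q < n) (N ^+ 2 * b q ^+ 2 + K ^+ 2 * u q 0 ^+ 2))).
  rewrite mulr_sumr; apply: ler_sum => q _.
  by have := sqr_ge0 (N * b q - K * u q 0); rewrite !expr2; nra.
rewrite big_split/= -!mulr_sumr N2.
have := ler_wpM2l (sqr_ge0 N) bK; rewrite !expr2; nra.
Qed.

Lemma signrM (x : R) : signr x * x = `|x|.
Proof. by rewrite /signr; case: ger0P => h; rewrite ?mul1r ?mulN1r. Qed.

(* An exact interpolant [u] of [d = A e_j] satisfies
   [|d|_1 = <A^T sgn d, u>], so only one dual vector needs to be controlled. *)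
Lemma l1_dense_error_signr A j (K : R) w : (0 < m)%N -> 0 < K ->
  col j A != 0 ->
  \sum_(q < n) (\sum_(i < m) signr (A i j) * A i q) ^+ 2 <= (K * m%:R) ^+ 2 ->
  l1_dense_error K^-1 A w.
Proof.
move=> m0 K0 Aj0 bK; exists (col j A); split => // what argmin.
have mp : 0 < m%:R :> R by rewrite ltr0n.
set u := what - w.
have Au : A *m u = col j A.
  (* The competitor [w + e_j] has zero loss, so the minimizer has zero loss too and interpolates [d]
     exactly. *)
  have := argmin (w + delta_mx j 0); rewrite mulmxDr -colE subrr => h.
  have /l1norm_eq0/eqP : l1norm (A *m w + col j A - A *m what) <= 0.
    apply: (le_trans h); rewrite /l1norm big1// => i _; rewrite mxE normr0//.
  rewrite subr_eq0 => /eqP h'.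
  by rewrite /u mulmxBr -h' addrC addKr.
rewrite -mulrA mulrC ler_pdivrMr// ler_pdivrMr// -mulrA mulrC.
apply: le_trans (cauchy_schwarz_l2norm u (mulr_gt0 K0 mp) bK).
rewrite le_eqVlt; apply/orP; left; apply/eqP.
transitivity (\sum_(i < m) signr (A i j) * (A *m u) i 0).
  by apply: eq_bigr => i _; rewrite Au mxE signrM.
under eq_bigr do rewrite mxE mulr_sumr.
rewrite exchange_big/=; apply: eq_bigr => q _; rewrite mulr_suml.
by apply: eq_bigr => i _; rewrite mulrA.
Qed.

End deterministic.
(** * Concentration *)

Section centered_statistics.
Context {R : realType}.
Local Open Scope ereal_scope.
Local Notation nu := (@normal_prob R 0 1).

(** This is the mean of [|x|], namely [sqrt (2 / pi)]. *)
Definition abs_mean : R := (2 * normal_peak 1)%R.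

(** It is positive exactly when [t^2 < 2 ln 2]. *)
Definition abs_step_mean (t : R) : R :=
  (abs_mean * (2 * expR (- (t ^+ 2 / 2)) - 1))%R.

Lemma abs_mean_gt0 : (0 < abs_mean)%R.
Proof. by rewrite mulr_gt0// normal_peak_gt0// oner_eq0. Qed.

Lemma integral_std_normal_centered (f : R -> R) (c : R) :
  nu.-integrable setT (EFin \o f) -> \int[nu]_x (f x)%:E = c%:E ->
  \int[nu]_x (f x - c)%:E = 0.
Proof.
move=> intf fc; under eq_integral do rewrite EFinB.
rewrite integralB//=; last exact: finite_measure_integrable_cst.
by rewrite fc integral_cst//= probability_setT mule1 subee.
Qed.

Lemma measurable_abs_ge_ind (t : R) : measurable_fun setT (abs_ge_ind t).
Proof.
apply: measurable_fun_ifT => //; apply: measurable_fun_ler => //.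
Qed.

Lemma measurable_abs_step (t : R) : measurable_fun setT (abs_step t).
Proof.
apply: measurable_fun_ifT => //; first exact: measurable_fun_ler.
exact: measurableT_comp.
Qed.

Lemma normr_abs_step (t x : R) : (`|abs_step t x| = `|x|)%R.
Proof. by rewrite /abs_step; case: ifP; rewrite ?normrN normr_id. Qed.

Lemma integral_abs_ge_ind (t : R) :
  \int[nu]_x (abs_ge_ind t x)%:E = nu (abs_ge t).
Proof.
rewrite -[in RHS](setIT (abs_ge t)) -integral_indic//; last exact: measurable_abs_ge.
apply: eq_integral => x _; rewrite indicE /abs_ge_ind; congr EFin.
case: ifPn => tx; first by rewrite mem_set.
by rewrite memNset//; exact/negP.
Qed.

(** The integrand is twice [|x|] restricted to [abs_ge t], minus [|x|]; both means are known. *)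
Lemma integral_abs_step (t : R) : (0 < t)%R ->
  \int[nu]_x (abs_step t x)%:E = (abs_step_mean t)%:E.
Proof.
move=> t0; pose g (x : R) : R := (`|x| * abs_ge_ind t x)%R.
have mg : measurable_fun setT g.
  by apply: measurable_funM => //; exact: measurable_abs_ge_ind.
have intg : nu.-integrable setT (EFin \o g).
  apply: (@integrable_std_normal _ _ 0%R) => // x; rewrite addr0 /g normrM normr_id.
  by rewrite ler_piMr// /abs_ge_ind; case: ifP; rewrite ?normr1 ?normr0.
have intabs : nu.-integrable setT (EFin \o (fun x : R => `|x|%R)).
  by apply: (@integrable_std_normal _ _ 0%R) => // x; rewrite addr0 normr_id.
have intgE : \int[nu]_x (g x)%:E = (abs_mean * expR (- (t ^+ 2 / 2)))%:E.
  rewrite -integral_abs_std_normal_tail// [RHS]integral_mkcond.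
  apply: eq_integral => x _; rewrite /g patchE /abs_ge_ind.
  case: ifPn => tx; first by rewrite mem_set// mulr1.
  by rewrite memNset ?mulr0//; exact/negP.
have -> : \int[nu]_x (abs_step t x)%:E =
    \int[nu]_x ((2%:E * (g x)%:E) - (`|x|)%:E).
  apply: eq_integral => x _; rewrite -EFinM -EFinB /abs_step /g /abs_ge_ind.
  by congr EFin; case: ifP => _; ring.
rewrite integralB//=; last exact: integrableZl.
rewrite integralZl// intgE integral_abs_std_normal -EFinM -EFinB.
by congr EFin; rewrite /abs_step_mean /abs_mean; ring.
Qed.

End centered_statistics.
(* [abs_step_mean] vanishes there: half of the mean of [|x|] lies beyond it. *)
Definition half_mass_threshold {R : realType} : R := Num.sqrt (2 * ln 2).

Lemma half_mass_threshold_ge1 {R : realType} : 1 <= half_mass_threshold :> R.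
Proof.
rewrite -[leLHS]sqrtr1 ler_sqrt ?mulr_ge0 ?ln_ge0 ?ler1n//.
(* [ln (1 + x) <= x] at [x = - 1/2] gives [ln 2 >= 1/2]. *)
have : ln (1 + - 2^-1 : R) <= - 2^-1 by apply: le_ln1Dx; lra.
have -> : 1 + - 2^-1 = 2^-1 :> R by lra.
by rewrite lnV ?posrE//; lra.
Qed.

(** With [tau] the half-mass threshold, [2 exp (- t^2 / 2)] equals [exp (tau eps / 2 - eps^2 / 8)]
    at [t = tau - eps / 2]. By [exp y >= 1 + y] and [tau >= 1] the excess over [1] is at least
    [eps / 4]. *)
Lemma abs_step_mean_ge {R : realType} (eps : R) : 0 < eps -> eps < 1 / 5 ->
  abs_mean * (eps / 4) <= abs_step_mean (half_mass_threshold - eps / 2).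
Proof.
move=> e0 e5; rewrite ler_pM2l ?abs_mean_gt0//.
set tau := half_mass_threshold; have tau1 : 1 <= tau by exact: half_mass_threshold_ge1.
have tau2 : tau ^+ 2 = 2 * ln 2 by rewrite sqr_sqrtr// mulr_ge0// ln_ge0// ler1n.
have -> : - ((tau - eps / 2) ^+ 2 / 2) = - ln 2 + (tau * eps / 2 - eps ^+ 2 / 8).
  by rewrite sqrrB tau2; field.
rewrite expRD expRN lnK ?posrE// mulrA divff// mul1r.
have := expR_ge1Dx (tau * eps / 2 - eps ^+ 2 / 8).
have : eps * 1 <= eps * tau by rewrite ler_pM2l.
by rewrite expr2; nra.
Qed.

Lemma abs_step_mean_le {R : realType} (t : R) : `|abs_step_mean t| <= abs_mean.
Proof.
rewrite normrM gtr0_norm ?abs_mean_gt0//.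
apply: ler_piMr; first exact/ltW/abs_mean_gt0.
have e1 : expR (- (t ^+ 2 / 2)) <= 1.
  by rewrite -expR0 ler_expR oppr_le0 divr_ge0// sqr_ge0.
have := expR_gt0 (- (t ^+ 2 / 2)).
by rewrite ler_norml; lra.
Qed.

Section deviation.
Context {R : realType} {d : measure_display} {T : measurableType d}.
Variables (P : probability T R) (m n : nat) (X : 'I_m -> 'I_n -> T -> R).
Hypothesis iidX : iid_std_gaussian P X.
Variable j0 : 'I_n.
Local Notation nu := (@normal_prob R 0 1).
(** A single variance constant: the offset [abs_mean + 1] dominates those of the centered
    [abs_step], the centered indicator, the centered [|x|] and the identity. *)
Local Notation V := (@sqr_bound R (abs_mean + 1)).

Let B_ge0 : 0 <= abs_mean + 1 :> R.
Proof. by rewrite addr_ge0// ltW// abs_mean_gt0. Qed.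

Let M_ge0 : 0 <= abs_mean :> R. Proof. by rewrite ltW// abs_mean_gt0. Qed.

Lemma abs_step_deviation (t a : R) : 0 < t -> 0 < a ->
  (P [set s | (a <= `|\sum_(i < m) (abs_step t (X i j0 s) - abs_step_mean t)|)%R]
   <= (m%:R * V / a ^+ 2)%:E)%E.
Proof.
move=> t0 a0; have mh := measurable_abs_step t.
apply: (std_normal_chebyshev (f := fun x => abs_step t x - abs_step_mean t)
  (pairwise_std_normal_col iidX j0)) => //.
- exact: measurable_funB.
- move=> x; apply: (le_trans (ler_normB _ _)); rewrite normr_abs_step lerD2l.
  by rewrite (le_trans (abs_step_mean_le t))// lerDl.
- apply: integral_std_normal_centered; last exact: integral_abs_step.
  by apply: (@integrable_std_normal _ _ 0%R) => // x; rewrite addr0 normr_abs_step.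
Qed.

Lemma abs_ge_ind_deviation (t a : R) : 0 < a ->
  (P [set s | (a <= `|\sum_(i < m)
     (abs_ge_ind t (X i j0 s) - fine (nu (abs_ge t)))|)%R]
   <= (m%:R * V / a ^+ 2)%:E)%E.
Proof.
move=> a0; have mh := measurable_abs_ge_ind t.
have mt : measurable (abs_ge t) by exact: measurable_abs_ge.
have p0 : 0 <= fine (nu (abs_ge t)) by rewrite fine_ge0.
have p1 : fine (nu (abs_ge t)) <= 1.
  by rewrite -lee_fin fineK ?fin_num_measure// probability_le1.
apply: (std_normal_chebyshev (f := fun x => abs_ge_ind t x - fine (nu (abs_ge t)))
  (pairwise_std_normal_col iidX j0)) => //.
- exact: measurable_funB.
- move=> x; apply: (@le_trans _ _ 1); last first.
    by rewrite addrA lerDr addr_ge0.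
  by rewrite /abs_ge_ind ler_norml; case: ifP => _; lra.
- apply: integral_std_normal_centered.
    apply: (@integrable_std_normal _ _ 1) => // x.
    by rewrite /abs_ge_ind; case: ifP => _; rewrite ?normr1 ?normr0 ?lerDr ?addr_ge0.
  by rewrite integral_abs_ge_ind fineK// fin_num_measure.
Qed.

Lemma abs_deviation (a : R) : 0 < a ->
  (P [set s | (a <= `|\sum_(i < m) (`|X i j0 s| - abs_mean)|)%R]
   <= (m%:R * V / a ^+ 2)%:E)%E.
Proof.
move=> a0.
apply: (std_normal_chebyshev (f := fun x => `|x| - abs_mean)
  (pairwise_std_normal_col iidX j0)) => //.
- exact: measurable_funB.
- move=> x; apply: (le_trans (ler_normB _ _)); rewrite normr_id lerD2l.
  by rewrite ger0_norm// lerDl.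
- apply: integral_std_normal_centered; last exact: integral_abs_std_normal.
  by apply: (@integrable_std_normal _ _ 0%R) => // x; rewrite addr0 normr_id.
Qed.

(** Each signed column sum with [q != j0] has second moment at most [m V]; adding over [q] and
    applying Markov suffices. Column [j0] is left out because its signed sum is the sum of the
    [|X i j0|], of order [m]. *)
Lemma cross_deviation (a : R) : 0 < a ->
  (P [set s | (a <= \sum_(q < n | q != j0)
     (\sum_(i < m) signr (X i j0 s) * X i q s) ^+ 2)%R]
   <= (n%:R * (m%:R * V) / a)%:E)%E.
Proof.
move=> a0; case: (iidX) => mX _ _.
have mS q : measurable_fun setT
    (fun s => (\sum_(i < m) signr (X i j0 s) * X i q s) ^+ 2).
  apply: measurable_funX; apply: measurable_sum => i.
  by apply: measurable_funM => //; apply: measurableT_comp => //; exact: measurable_signr.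
apply: markov_le => //.
(* The condition [q != j0] is moved into the index list, the form to which [measurable_sum]
   applies. *)
- by under eq_fun do rewrite -big_filter; exact: measurable_sum.
- by move=> s; apply: sumr_ge0 => q _; exact: sqr_ge0.
under eq_integral do rewrite -sumEFin -big_filter.
rewrite ge0_integral_sum//; last 2 first.
- by move=> q; apply/measurable_EFinP.
- by move=> q s _; rewrite lee_fin sqr_ge0.
rewrite big_filter.
apply: (@le_trans _ _ (\sum_(q < n | q != j0) (m%:R * V)%:E)%E).
  apply: lee_sum => q qj0.
  apply: (integral_sqr_sum_std_normal_le (f := id)
    (pairwise_std_normal_signr_col iidX qj0)) => //.
    by move=> x; rewrite lerDl.
  exact: integral_std_normal_id.
have V0 : 0 <= V by rewrite (le_trans ler01)// sqr_bound_ge1// lerDr.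
rewrite sumEFin lee_fin sumr_const -[leLHS]mulr_natl ler_wpM2r ?mulr_ge0//.
by rewrite ler_nat (leq_trans (max_card _))// card_ord.
Qed.

End deviation.

(** * Sample size and the good event *)

Lemma chebyshev_ratio_le {R : realType} (N v a del : R) :
  0 < N -> 0 < a -> 0 < del -> 4 * v / del <= N * a ^+ 2 ->
  N * v / (N * a) ^+ 2 <= del / 4.
Proof.
move=> N0 a0 d0; rewrite ler_pdivrMr// => h.
rewrite ler_pdivrMr ?exprn_gt0 ?mulr_gt0// exprMn.
have := ler_wpM2l (ltW N0) h.
rewrite (expr2 N); lra.
Qed.

(** One lower bound on [N] has to serve four deviations. The term [16 / M^2] comes from the margin
    [M eps / 4], the term [4] from [eps / 2], and the factor [n] pays for the cross columns; [K]
    will be [4 V / delta]. *)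
Lemma sample_size_bounds {R : realType} (K eps M N n mean : R) :
  0 < K -> 0 < eps -> eps < 1 / 5 -> 0 < M -> 1 <= n ->
  K * (16 / M ^+ 2 + 4) * n <= N * eps ^+ 2 -> M * (eps / 4) <= mean ->
  [/\ 0 < N, K <= N * mean ^+ 2, K <= N * (eps / 2) ^+ 2,
      K <= N * 1 ^+ 2 & K * n <= N].
Proof.
move=> K0 e0 e5 M0 n1 hN hmean.
have r0 : 0 < 16 / M ^+ 2 by rewrite divr_gt0// exprn_gt0.
have Kn : K <= K * n by rewrite ler_peMr// ltW.
have Kn0 : 0 < K * n by exact: lt_le_trans Kn.
have e2 : 0 < eps ^+ 2 by exact: exprn_gt0.
have e2le : eps ^+ 2 <= 1 by rewrite expr2; nra.
have hr : K * n * (16 / M ^+ 2) <= N * eps ^+ 2.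
  by apply: le_trans hN; rewrite [leRHS]mulrAC ler_pM2l// lerDl.
have h4 : K * n * 4 <= N * eps ^+ 2.
  by apply: le_trans hN; rewrite [leRHS]mulrAC ler_pM2l// lerDr ltW.
have N0 : 0 < N.
  by rewrite -(pmulr_lgt0 _ e2); apply: lt_le_trans h4; rewrite mulr_gt0.
have NeN : N * eps ^+ 2 <= N by rewrite ler_piMr// ltW.
split => //.
- apply: (@le_trans _ _ (N * (M * (eps / 4)) ^+ 2)); last first.
    have a0 : 0 <= M * (eps / 4) by rewrite mulr_ge0 ?divr_ge0 ?ltW.
    by rewrite ler_pM2l// ler_sqr ?nnegrE// (le_trans a0).
  have -> : N * (M * (eps / 4)) ^+ 2 = N * eps ^+ 2 * (M ^+ 2 / 16) by field.
  have -> : K = K * (16 / M ^+ 2) * (M ^+ 2 / 16) by field; rewrite gt_eqF.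
  rewrite ler_pM2r ?divr_gt0 ?exprn_gt0//; apply: le_trans hr.
  by rewrite ler_pM2r.
- by have -> : N * (eps / 2) ^+ 2 = N * eps ^+ 2 / 4; [field|lra].
- by rewrite expr1n; lra.
- by lra.
Qed.

(** A union bound over four bad events of probability at most [delta / 4] each. Of the slack [eps]
    in the corruption level, one half pays for the lowered threshold and the other for the
    fluctuation of the count. *)
Lemma l1_regression_good_event {R : realType} (delta eps : R) (m n : nat)
    (dT : measure_display) (T : measurableType dT) (P : probability T R)
    (X : 'I_m -> 'I_n -> T -> R) (j0 : 'I_n)
    (V := sqr_bound (abs_mean + 1)) (t := half_mass_threshold - eps / 2) :
  0 < delta -> 0 < eps -> eps < 1 / 5 ->
  4 * V / delta * (16 / abs_mean ^+ 2 + 4) * n%:R <= m%:R * eps ^+ 2 ->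
  iid_std_gaussian P X ->
  exists E : set T, measurable E /\ ((1 - delta)%:E <= P E)%E /\
    forall s, E s ->
    [/\ 0 < \sum_(i < m) abs_step t (X i j0 s),
        \sum_(i < m) abs_ge_ind t (X i j0 s) <= (eta0 R + eps) * m%:R &
        \sum_(q < n) (\sum_(i < m) signr (X i j0 s) * X i q s) ^+ 2
          <= ((abs_mean + 2) * m%:R) ^+ 2].
Proof.
move=> d0 e0 e5 hm iidX; case: (iidX) => mX _ _.
have M0 : 0 < abs_mean :> R by exact: abs_mean_gt0.
have V1 : 1 <= V by apply: sqr_bound_ge1; rewrite lerDr ltW.
have n1 : 1 <= n%:R :> R by rewrite ler1n (leq_ltn_trans _ (ltn_ord j0)).
have tau1 : 1 <= half_mass_threshold :> R by exact: half_mass_threshold_ge1.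
have t0 : 0 < t by rewrite /t; lra.
have K0 : 0 < 4 * V / delta by rewrite divr_gt0// mulr_gt0//; exact: lt_le_trans V1.
have [mgt0 h1 h2 h3 h4] := sample_size_bounds K0 e0 e5 M0 n1 hm (abs_step_mean_ge e0 e5).
rewrite -/t in h1.
have mean_gt0 : 0 < abs_step_mean t.
  by apply: lt_le_trans (abs_step_mean_ge e0 e5); rewrite mulr_gt0// divr_gt0.
pose S1 s := \sum_(i < m) (abs_step t (X i j0 s) - abs_step_mean t).
pose p := fine (normal_prob 0 1 (abs_ge t)).
pose S2 s := \sum_(i < m) (abs_ge_ind t (X i j0 s) - p).
pose S3 s : R := \sum_(i < m) (`|X i j0 s| - abs_mean).
pose S4 s := \sum_(q < n | q != j0)
  (\sum_(i < m) signr (X i j0 s) * X i q s) ^+ 2.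
(* The bad events: the [abs_step] sum deviates by its whole mean, the count of large entries by
   [m eps / 2], the column sum of [|X i j0|] by [m]; or the cross energy reaches [m^2]. *)
pose b1 := [set s | m%:R * abs_step_mean t <= `|S1 s|].
pose b2 := [set s | m%:R * (eps / 2) <= `|S2 s|].
pose b3 := [set s | m%:R * 1 <= `|S3 s|].
pose b4 := [set s | m%:R ^+ 2 <= S4 s].
have P1 : (P b1 <= (delta / 4)%:E)%E.
  apply: (le_trans (abs_step_deviation iidX j0 t0 _)); first exact: mulr_gt0.
  rewrite lee_fin; apply: chebyshev_ratio_le => //.
have P2 : (P b2 <= (delta / 4)%:E)%E.
  apply: (le_trans (abs_ge_ind_deviation iidX j0 t _)).
    by rewrite mulr_gt0// divr_gt0.
  rewrite lee_fin; apply: chebyshev_ratio_le => //; by rewrite divr_gt0.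
have P3 : (P b3 <= (delta / 4)%:E)%E.
  apply: (le_trans (abs_deviation iidX j0 _)); first exact: mulr_gt0.
  rewrite lee_fin; apply: chebyshev_ratio_le => //.
have P4 : (P b4 <= (delta / 4)%:E)%E.
  apply: (le_trans (cross_deviation iidX j0 _)); first exact: exprn_gt0.
  rewrite lee_fin ler_pdivrMr ?exprn_gt0//.
  have -> : n%:R * (m%:R * sqr_bound (abs_mean + 1)) = m%:R * (n%:R * V).
    by rewrite mulrCA.
  have -> : delta / 4 * m%:R ^+ 2 = m%:R * (delta / 4 * m%:R) by ring.
  rewrite ler_pM2l//; move: h4; rewrite mulrAC ler_pdivrMr//; lra.
have mle (g : T -> R) a : measurable_fun setT g -> measurable [set s | a <= g s].
  move=> mg; have -> : [set s | a <= g s] = setT `&` g @^-1` `[a, +oo[.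
    by rewrite setTI; apply/seteqP; split => s /=; rewrite in_itv/= andbT.
  by apply: mg => //; exact: measurable_itv.
have mSum (f : R -> R) (c : R) : measurable_fun setT f ->
    measurable_fun setT (fun s => `|\sum_(i < m) (f (X i j0 s) - c)|).
  move=> mf; apply: measurableT_comp => //; apply: measurable_sum => i.
  by apply: measurable_funB => //; exact: measurableT_comp.
have mb1 : measurable b1.
  by apply: mle; apply: (mSum (abs_step t)); exact: measurable_abs_step.
have mb2 : measurable b2.
  by apply: mle; apply: (mSum (abs_ge_ind t)); exact: measurable_abs_ge_ind.
have mb3 : measurable b3 by apply: mle; exact: (mSum (fun x => `|x|)).
have mb4 : measurable b4.
  apply: mle; rewrite /S4; under eq_fun do rewrite -big_filter.
  apply: measurable_sum => q; apply: measurable_funX; apply: measurable_sum => i.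
  by apply: measurable_funM => //; apply: measurableT_comp => //; exact: measurable_signr.
have mb12 : measurable (b1 `|` b2) by exact: measurableU.
have mb34 : measurable (b3 `|` b4) by exact: measurableU.
have mbad : measurable (b1 `|` b2 `|` (b3 `|` b4)) by exact: measurableU.
have Pbad : (P (b1 `|` b2 `|` (b3 `|` b4)) <= delta%:E)%E.
  have -> : delta = (delta / 4 + delta / 4) + (delta / 4 + delta / 4) by lra.
  rewrite !EFinD; apply: (le_trans (measureU2 _ _ _)) => //.
  by apply: leeD; apply: (le_trans (measureU2 _ _ _)) => //; exact: leeD.
exists (~` (b1 `|` b2 `|` (b3 `|` b4))); split; first exact: measurableC.
split; first by rewrite probability_setC// EFinB leeB.
move=> s /not_orP[/not_orP[/negP nb1 /negP nb2] /not_orP[/negP nb3 /negP nb4]].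
move: nb1 nb2 nb3 nb4; rewrite -!ltNge => nb1 nb2 nb3 nb4.
have sumE (f : R -> R) (c : R) : \sum_(i < m) f (X i j0 s) =
    \sum_(i < m) (f (X i j0 s) - c) + m%:R * c.
  by rewrite sumrB sumr_const card_ord mulr_natl subrK.
split.
- rewrite (sumE (abs_step t) (abs_step_mean t)) -/(S1 s).
  by move: nb1; rewrite ltr_norml => /andP[]; lra.
- rewrite (sumE (abs_ge_ind t) p) -/(S2 s).
  have ple : p <= eta0 R + eps / 2.
    have ttau : t <= half_mass_threshold by rewrite /t; lra.
    have mt : measurable (abs_ge t) by exact: measurable_abs_ge.
    rewrite -lee_fin fineK ?fin_num_measure//.
    apply: (le_trans (std_normal_abs_ge_le t0 ttau)); rewrite lee_fin /eta0 /t.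
    by rewrite /half_mass_threshold; lra.
  have := ler_wpM2l (ltW mgt0) ple.
  by move: nb2; rewrite ltr_norml => /andP[_]; lra.
(* The [j0] term is at most [(m (abs_mean + 1))^2] and the others add less than [m^2];
   [(abs_mean + 1)^2 + 1 <= (abs_mean + 2)^2] closes the bound. *)
- rewrite (bigD1 j0)//= -/(S4 s).
  under [X in X ^+ 2]eq_bigr do rewrite signrM.
  have : 0 <= \sum_(i < m) `|X i j0 s| by exact: sumr_ge0.
  rewrite (sumE (fun x => `|x|) abs_mean) -/(S3 s).
  move: nb3; rewrite ltr_norml => /andP[_] nb3 sum0.
  have : (S3 s + m%:R * abs_mean) ^+ 2 <= (m%:R * (abs_mean + 1)) ^+ 2.
    have le_sum : S3 s + m%:R * abs_mean <= m%:R * (abs_mean + 1) by lra.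
    by rewrite ler_sqr ?nnegrE// (le_trans sum0).
  have : 0 <= m%:R ^+ 2 * abs_mean :> R by rewrite mulr_ge0 ?sqr_ge0 ?ltW.
  by have := sqr_ge0 (m%:R : R); move: nb4; lra.
Qed.

Theorem theorem6p1 (R : realType) :
  exists c : R, 0 < c /\
  forall delta : R, 0 < delta ->
  exists C : R, 0 < C /\
  forall (eps eta : R) (m n : nat) (dT : measure_display) (T : measurableType dT)
         (P : probability T R) (X : 'I_m -> 'I_n -> T -> R) (wstar : 'cV[R]_n),
    0 < eps -> eps < 1 / 5 ->
    C * n%:R / eps ^+ 2 <= m%:R ->
    wstar != 0 ->
    iid_std_gaussian P X ->
    exists E : set T, measurable E /\ ((1 - delta)%:E <= P E)%E /\
      forall t, E t ->
        (eta0 R + eps < eta -> l1_fails eta (design X t) wstar) /\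
        l1_dense_error c (design X t) wstar.
Proof.
have M0 : 0 < abs_mean :> R by exact: abs_mean_gt0.
(* The constant is the inverse of the factor in [|A^T s|_2 <= (abs_mean + 2) m]. *)
exists (abs_mean + 2)^-1; split; first by rewrite invr_gt0 addr_gt0.
move=> delta d0.
exists (4 * sqr_bound (abs_mean + 1) / delta * (16 / abs_mean ^+ 2 + 4)).
split.
  have V0 : 0 < sqr_bound (abs_mean + 1) :> R.
    by rewrite (lt_le_trans ltr01)// sqr_bound_ge1// lerDr ltW.
  have r0 : 0 < 16 / abs_mean ^+ 2 :> R by apply: divr_gt0 => //; exact: exprn_gt0.
  by apply: mulr_gt0; [apply: divr_gt0 => //; exact: mulr_gt0|exact: addr_gt0].
move=> eps eta m n dT T P X w e0 e5 hm w0 iidX.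
(* A nonzero vector has a nonzero entry; its index selects the column for both parts. *)
have [j0 _] : exists j0, w j0 0 != 0.
  apply/existsP; apply: contraNT w0; rewrite negb_exists => /forallP w0.
  apply/eqP/matrixP => i k; rewrite (ord1 k) mxE; apply/eqP.
  by have := w0 i; rewrite negbK.
move: hm; rewrite ler_pdivrMr ?exprn_gt0// => hm.
have [E [mE [PE good]]] := l1_regression_good_event j0 d0 e0 e5 hm iidX.
exists E; split => //; split => // t /good[step_gt0 card_le cross_le].
(* An empty sum could not be positive. *)
have m0 : (0 < m)%N.
  rewrite lt0n; apply: contraTneq step_gt0 => m0.
  by rewrite big1 ?ltxx// => i; have := ltn_ord i; rewrite [X in (_ < X)%N]m0.
split => [eta_gt|].
  apply: (l1_fails_threshold (j := j0) (t := half_mass_threshold - eps / 2)).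
    under eq_bigr do rewrite mxE.
    by apply: (le_trans card_le); rewrite ler_wpM2r// ltW.
  by under eq_bigr do rewrite mxE.
apply: (l1_dense_error_signr (j := j0)) => //.
- by rewrite addr_gt0.
(* A zero column would make every [abs_step] term vanish, against the positivity of their sum. *)
- apply/eqP => /matrixP col0.
  have X0 i : X i j0 t = 0 by have := col0 i 0; rewrite !mxE.
  move: step_gt0; rewrite big1 ?ltxx// => i _.
  by rewrite X0 /abs_step normr0 oppr0; case: ifP.
- apply: le_trans cross_le; rewrite le_eqVlt; apply/orP; left; apply/eqP.
  by apply: eq_bigr => q _; congr (_ ^+ 2); apply: eq_bigr => i _; rewrite !mxE.
Qed.
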